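(* Let $k,d\geq1$ be integers with $k\equiv d\pmod 2$. If $d\leq4$, then $$\mathrm{Fil}_d\,\mathcal Z_{\mathcal A,k}^{\mathrm f}\subseteq\mathrm{Fil}_{d-1}\,\mathcal Z_{\mathcal A,k}^{\mathrm f}.$$
   Context: Let $\mathfrak H=\mathbb Q\langle x,y\rangle$, $\mathfrak H^1=\mathbb Q+\mathfrak Hy$, $z_k=x^{k-1}y$ for $k\ge1$. The words in $\mathfrak H^1$ are the empty word $\mathbf 1$ and $z_{k_1}\cdots z_{k_r}$ ($k_i\ge1$), of weight $\mathrm{wt}=k_1+\cdots+k_r$ and depth $r$. The stuffle product $*$ on $\mathfrak H^1$ is bilinear with $\mathbf 1*w=w*\mathbf 1=w$ and $z_aw*z_bv=z_a(w*z_bv)+z_b(z_aw*v)+z_{a+b}(w*v)$. The shuffle product $\mathrm{sh}$ on $\mathfrak H$ is bilinear with $\mathbf 1\,\mathrm{sh}\,w=w\,\mathrm{sh}\,\mathbf 1=w$ and $au\,\mathrm{sh}\,bv=a(u\,\mathrm{sh}\,bv)+b(au\,\mathrm{sh}\,v)$ for $a,b\in\{x,y\}$. Let $\mathfrak H^1_*$ be $\mathfrak H^1$ with the commutative product $*$, and let $R(z_{k_1}\cdots z_{k_r})=z_{k_r}\cdots z_{k_1}$. The algebra of formal finite multiple zeta values is $\mathcal Z_{\mathcal A}^{\mathrm f}=\mathfrak H^1_*/\mathfrak L$, where $\mathfrak L$ is the ideal of $\mathfrak H^1_*$ generated by $w\,\mathrm{sh}\,v-(-1)^{\mathrm{wt}(w)}R(w)v$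 for all words $w,v\in\mathfrak H^1$ ($R(w)v$ is concatenation). It is graded by weight with weight-$k$ part $\mathcal Z_{\mathcal A,k}^{\mathrm f}$. The class of $z_{k_1}\cdots z_{k_r}$ is $\zeta_{\mathcal A}^{\mathrm f}(k_1,\ldots,k_r)$. For $d\ge0$, $$\mathrm{Fil}_d\,\mathcal Z_{\mathcal A,k}^{\mathrm f}=\mathrm{span}_{\mathbb Q}\{\zeta_{\mathcal A}^{\mathrm f}(k_1,\ldots,k_r): r\le d,\ k_1+\cdots+k_r=k\}.$$ *)

(* Defs.v *)
From HB Require Import structures.
From mathcomp Require Import all_boot all_order all_algebra.
From mathcomp Require Import generic_quotient ring_quotient finmap.
From mathcomp Require Import boolp classical_sets.
From mathcomp.multinomials Require Import monalg.

Set Implicit Arguments.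
Unset Strict Implicit.
Unset Printing Implicit Defensive.

Import GRing.Theory.
Local Open Scope ring_scope.
Local Open Scope quotient_scope.

(* Q<x,y> is the monoid algebra of the free monoid on two letters; the letter
   x is encoded by false and y by true. *)
Notation QXY := {malg rat[{fmonom bool}]}.

Definition word (u : seq bool) : QXY := << FMonom u >>.
Definition letter (b : bool) : QXY := word [:: b].
Definition X : QXY := letter false.
Definition Y : QXY := letter true.

Definition z (k : nat) : QXY := X ^+ (k - 1) * Y.

(* z_{k_1} ... z_{k_r} for s = [:: k_1; ...; k_r]; only meaningful when s is an
   index, i.e. when every k_i >= 1. *)
Definition zword (s : seq nat) : QXY := \prod_(k <- s) z k.
Definition is_index (s : seq nat) : bool := all (leq 1) s.

Definition linext (V : lmodType rat) (p : seq bool -> V) (f : QXY) : V :=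
  \sum_(u <- msupp f) f@_u *: p u.
Definition bilinext (p : seq bool -> seq bool -> QXY) (f g : QXY) : QXY :=
  linext (fun u => linext (p u) g) f.

Fixpoint shuffle_word (u v : seq bool) : QXY :=
  if u is a :: u' then
    (fix aux v := if v is b :: v'
       then letter a * shuffle_word u' v + letter b * aux v'
       else word u) v
  else word v.
Definition shuffle : QXY -> QXY -> QXY := bilinext shuffle_word.

(* [blocks 0 u] is the index s with word u = zword s when u is empty or ends
   with y; n counts the letters x read since the last y. A trailing block
   of x's is discarded: it does not occur in words of H^1. *)
Fixpoint blocks (n : nat) (u : seq bool) : seq nat :=
  match u with
  | [::] => [::]
  | false :: u' => blocks n.+1 u'
  | true :: u' => n.+1 :: blocks 0 u'
  end.

Fixpoint stuffle_index (s t : seq nat) : QXY :=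
  if s is a :: s' then
    (fix aux t := if t is b :: t'
       then z a * stuffle_index s' t + z b * aux t'
            + z (a + b) * stuffle_index s' t'
       else zword s) t
  else zword t.
Definition stuffle : QXY -> QXY -> QXY :=
  bilinext (fun u v => stuffle_index (blocks 0 u) (blocks 0 v)).

Definition in_H1 : {pred QXY} :=
  fun f => `[< exists (c : rat) (g : QXY), f = c%:A + g * Y >].

Record H1 := MkH1 { H1val :> QXY; H1valP : H1val \in in_H1 }.

(* The quasi-shuffle computations are done in an abstract algebra: failing
   unification problems between concrete elements of Q<x,y> are expensive. *)
Section QuasiShuffle.
Variables (A : lalgType rat) (z : nat -> A) (S : A -> Prop) (W : seq nat -> A).
Variables (si : seq nat -> seq nat -> A) (st : A -> A -> A).
Hypothesis mulZ : forall (c : rat) (f g : A), c *: (f * g) = f * (c *: g).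
Hypothesis W0 : W [::] = 1.
Hypothesis W_cons : forall a s, W (a :: s) = z a * W s.
Hypothesis S_ind : forall P : A -> Prop,
    (forall c f g, P f -> P g -> P (c *: f + g)) ->
    (forall s, is_index s -> P (W s)) ->
  forall f, S f -> P f.
Hypothesis S_W : forall s, S (W s).
Hypothesis S_st : forall f g, S (st f g).
Hypothesis si0s : forall s, si [::] s = W s.
Hypothesis sis0 : forall s, si s [::] = W s.
Hypothesis si_cons : forall a s b t, si (a :: s) (b :: t) =
  z a * si s (b :: t) + z b * si (a :: s) t + z (a + b) * si s t.
Hypothesis st_linl : forall c f g h, st (c *: f + g) h = c *: st f h + st g h.
Hypothesis st_linr : forall c f g h, st h (c *: f + g) = c *: st h f + st h g.
Hypothesis stW : forall s t, is_index s -> is_index t -> st (W s) (W t) = si s t.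

Lemma qsh_siC s t : si s t = si t s.
Proof.
elim: s t => [|a s IHs] t; first by rewrite si0s sis0.
elim: t => [|b t IHt]; first by rewrite si0s sis0.
by rewrite !si_cons IHs IHt IHs [(b + a)%N]addnC (addrC (z a * _)).
Qed.

Lemma qsh_1l f : S f -> st 1 f = f.
Proof.
move: f; apply: S_ind => [c f g Pf Pg|s sI]; first by rewrite st_linr Pf Pg.
by rewrite -W0 stW // si0s.
Qed.

Lemma qshC f g : S f -> S g -> st f g = st g f.
Proof.
move=> fS; move: f fS g; apply: (@S_ind (fun f => forall g, _ -> _)).
  by move=> c f g Pf Pg h hH; rewrite st_linr st_linl Pf ?Pg.
move=> s sI; apply: S_ind => [c f g Pf Pg|t tI].
  by rewrite st_linr st_linl Pf Pg.
by rewrite !stW // qsh_siC.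
Qed.

Lemma qsh_z a b f g : (0 < a)%N -> (0 < b)%N -> S f -> S g ->
  st (z a * f) (z b * g) =
    z a * st f (z b * g) + z b * st (z a * f) g + z (a + b) * st f g.
Proof.
move=> a0 b0 fS; move: f fS g; apply: (@S_ind (fun f => forall g, _ -> _)).
  move=> c f g Pf Pg h hH.
  rewrite mulrDr -mulZ !st_linl Pf // Pg // !mulrDr -!mulZ !scalerDr.
  by rewrite (AC (3*3) ((1*4)*(2*5)*(3*6))).
move=> s sI; apply: S_ind => [c f g Pf Pg|t tI].
  rewrite mulrDr -mulZ !st_linr Pf Pg !mulrDr -!mulZ !scalerDr.
  by rewrite (AC (3*3) ((1*4)*(2*5)*(3*6))).
have asI : is_index (a :: s) by rewrite /= a0.
have btI : is_index (b :: t) by rewrite /= b0.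
by rewrite -!W_cons !stW.
Qed.

Let stD f g h : st (f + g) h = st f h + st g h.
Proof. by rewrite -[f]scale1r st_linl !scale1r. Qed.
Let stDr f g h : st h (f + g) = st h f + st h g.
Proof. by rewrite -[f]scale1r st_linr !scale1r. Qed.

Lemma qshA f g h : S f -> S g -> S h -> st f (st g h) = st (st f g) h.
Proof.
move=> fS gS hS; move: f fS g gS h hS.
apply: (@S_ind (fun f => forall g, _ -> forall h, _ -> _)).
  by move=> c f g Pf Pg h hS k kS; rewrite !st_linl Pf ?Pg.
move=> s sI; apply: (@S_ind (fun f => forall g, _ -> _)).
  by move=> c f g Pf Pg h hS; rewrite !(st_linl, st_linr) Pf ?Pg.
move=> t tI; apply: S_ind => [c f g Pf Pg|r rI]; first by rewrite !st_linr Pf Pg.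
have [n] := ubnP (size s + size t + size r)%N.
elim: n s t r sI tI rI => // n IH s t r sI tI rI.
have st1 f : S f -> st f 1 = f by move=> fS; rewrite qshC // -?W0 // W0 qsh_1l.
case: s sI => [|a s] sI; first by rewrite W0 !qsh_1l.
case: t tI => [|b t] tI; first by rewrite W0 qsh_1l // st1.
case: r rI => [|c r] rI; first by rewrite W0 !st1.
have [[/andP[a0 s'I] /andP[b0 t'I]] /andP[c0 r'I]] := (sI, tI, rI).
rewrite /= !(addSn, addnS) !ltnS => lt_n.
have IH1 := IH s (b :: t) (c :: r) s'I tI rI.
have IH2 := IH (a :: s) t (c :: r) sI t'I rI.
have IH3 := IH (a :: s) (b :: t) r sI tI r'I.
have IH4 := IH s t (c :: r) s'I t'I rI.
have IH5 := IH s (b :: t) r s'I tI r'I.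
have IH6 := IH (a :: s) t r sI t'I r'I.
have IH7 := IH s t r s'I t'I r'I.
move: IH1 IH2 IH3 IH4 IH5 IH6 IH7 => /=; rewrite !(addSn, addnS).
have lt2 m : (m.+1 < n -> m < n)%N by apply: ltn_trans.
move=> /(_ lt_n) IH1 /(_ lt_n) IH2 /(_ lt_n) IH3.
move=> /(_ (lt2 _ lt_n)) IH4 /(_ (lt2 _ lt_n)) IH5 /(_ (lt2 _ lt_n)) IH6.
move=> /(_ (lt2 _ (lt2 _ lt_n))) IH7.
rewrite !W_cons in IH1 IH2 IH3 IH4 IH5 IH6 IH7 *.
have SW k u : S (z k * W u) by rewrite -W_cons.
rewrite (qsh_z b0 c0) // (qsh_z a0 b0) // !stDr !stD.
have bc0 : (0 < b + c)%N by rewrite addn_gt0 b0.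
have ab0 : (0 < a + b)%N by rewrite addn_gt0 a0.
rewrite (qsh_z a0 b0 (S_W s) (S_st (W t) (z c * W r))).
rewrite (qsh_z a0 c0 (S_W s) (S_st (z b * W t) (W r))).
rewrite (qsh_z a0 bc0 (S_W s) (S_st (W t) (W r))).
rewrite (qsh_z a0 c0 (S_st (W s) (z b * W t)) (S_W r)).
rewrite (qsh_z b0 c0 (S_st (z a * W s) (W t)) (S_W r)).
rewrite (qsh_z ab0 c0 (S_st (W s) (W t)) (S_W r)).
rewrite (AC ((3*3)*3) ((1*4*7)*2*3*5*6*8*9)).
rewrite [RHS](AC ((3*3)*3) (1*4*7*(2*5*8)*3*6*9)).
rewrite /= -!mulrDr -!stDr -!stD -(qsh_z b0 c0) // -(qsh_z a0 b0) //.
by rewrite IH1 IH2 IH3 IH4 IH5 IH6 IH7 !addnA.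
Qed.

Lemma qsh_aug (aug : A -> rat) :
    (forall f g, aug (f + g) = aug f + aug g) ->
    (forall c f, aug (c *: f) = c * aug f) ->
    (forall a f, aug (z a * f) = 0) -> aug 1 = 1 ->
  forall f g, S f -> S g -> aug (st f g) = aug f * aug g.
Proof.
move=> augD augZ aug_z aug1.
have augW s : aug (W s) = (nilp s)%:R.
  by case: s => [|a s]; rewrite ?W0 ?W_cons.
move=> f g fS; move: f fS g; apply: (@S_ind (fun f => forall g, _ -> _)).
  by move=> c f g Pf Pg h hS; rewrite st_linl !augD !augZ Pf ?Pg // mulrDl mulrA.
move=> s sI; apply: S_ind => [c f g Pf Pg|t tI].
  by rewrite st_linr !augD !augZ Pf Pg mulrDr mulrCA.
rewrite stW // !augW.
case: s sI => [|a s] sI; first by rewrite si0s augW mul1r.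
case: t tI => [|b t] tI; first by rewrite sis0 augW mulr1.
by rewrite si_cons !augD !aug_z !addr0 mul0r.
Qed.

End QuasiShuffle.

Section LinExt.
Variables (V : lmodType rat) (p : seq bool -> V).

Lemma linextw (d : {fset {fmonom bool}}) f : (msupp f `<=` d)%fset ->
  linext p f = \sum_(u <- d) f@_u *: p u.
Proof.
move=> le_fd; apply: big_fset_incl => // u _ /mcoeff_outdom ->.
by rewrite scale0r.
Qed.

Lemma linextD f g : linext p (f + g) = linext p f + linext p g.
Proof.
rewrite (linextw (msuppD_le f g)) (linextw (fsubsetUl (msupp f) (msupp g))).
rewrite (linextw (fsubsetUr (msupp f) (msupp g))) -big_split.
by apply: eq_bigr => u _; rewrite mcoeffD scalerDl.
Qed.

Lemma linextZ c f : linext p (c *: f) = c *: linext p f.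
Proof.
rewrite (linextw (msuppZ_le c f)) /linext scaler_sumr.
by apply: eq_bigr => u _; rewrite mcoeffZ scalerA.
Qed.

Lemma linext_word u : linext p (word u) = p u.
Proof.
by rewrite /linext /word msuppU1 big_seq_fset1 mcoeffUU scale1r.
Qed.
End LinExt.

Section BilinExt.
Variable p : seq bool -> seq bool -> QXY.

Lemma bilinextDl f g h :
  bilinext p (f + g) h = bilinext p f h + bilinext p g h.
Proof. exact: linextD. Qed.
Lemma bilinextZl c f h : bilinext p (c *: f) h = c *: bilinext p f h.
Proof. exact: linextZ. Qed.
Lemma bilinextDr f g h :
  bilinext p h (f + g) = bilinext p h f + bilinext p h g.
Proof.
rewrite /bilinext [LHS]/linext -big_split; apply: eq_bigr => u _.
by rewrite linextD scalerDr.
Qed.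
Lemma bilinextZr c f h : bilinext p h (c *: f) = c *: bilinext p h f.
Proof.
rewrite /bilinext {1}/linext scaler_sumr; apply: eq_bigr => u _.
by rewrite linextZ !scalerA mulrC.
Qed.
Lemma bilinext_word u v : bilinext p (word u) (word v) = p u v.
Proof. by rewrite /bilinext !linext_word. Qed.
End BilinExt.

Lemma wordM u v : word u * word v = word (u ++ v).
Proof.
rewrite /word malgM_def fgmulUU mulr1; congr (mkmalgU _ _).
by apply/eqP; rewrite -val_eqE /= fmM.
Qed.

Lemma word0 : word [::] = 1.
Proof.
have E : FMonom [::] = mone :> {fmonom bool}.
  by apply/eqP; rewrite -val_eqE /= fm1.
by rewrite /word E.
Qed.

Lemma mulQXY_scaler (c : rat) (f g : QXY) : c *: (f * g) = f * (c *: g).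
Proof.
have cC : c%:MP * f = f * c%:MP.
  rewrite (monalgE f) mulr_sumr mulr_suml; apply: eq_bigr => k _.
  by rewrite !malgM_def !fgmulUU mul1m mulm1 mulrC.
rewrite -(mul_malgC c (f * g)).
rewrite -(mul_malgC c g).
rewrite (mulrA c%:MP f g).
rewrite (mulrA f c%:MP g).
by rewrite cC; reflexivity.
Qed.

Lemma H1P f : reflect (exists (c : rat) (g : QXY), f = c%:A + g * Y) (f \in in_H1).
Proof. exact: asboolP. Qed.

Lemma in_H1_submod : submod_closed in_H1.
Proof.
split=> [|c f g /H1P[a [f' ->]] /H1P[b [g' ->]]]; apply/H1P.
  by exists 0, 0; rewrite scale0r mul0r addr0.
exists (c * a + b), (c *: f' + g').
by rewrite scalerDr mulrDl scalerDl scalerA scalerAl addrACA.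
Qed.

HB.instance Definition _ := GRing.isSubmodClosed.Build rat QXY in_H1 in_H1_submod.
HB.instance Definition _ := [isSub for H1val].
HB.instance Definition _ := [Choice of H1 by <:].
HB.instance Definition _ := [SubChoice_isSubLmodule of H1 by <:].

Lemma H1_Y g : g * Y \in in_H1.
Proof. by apply/H1P; exists 0, g; rewrite scale0r add0r. Qed.

Lemma H1_1 : 1 \in in_H1.
Proof. by apply/H1P; exists 1, 0; rewrite scale1r mul0r addr0. Qed.

Lemma H1_Ml f g : f \in in_H1 -> g \in in_H1 -> f * g \in in_H1.
Proof.
move=> fH /H1P[b [g' ->]]; rewrite mulrDr mulrA; apply: rpredD.
  by rewrite -(mulQXY_scaler b f 1) mulr1; apply: rpredZ.
exact: H1_Y.
Qed.

Lemma H1_z k : z k \in in_H1. Proof. exact: H1_Y. Qed.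

Lemma H1_zword s : zword s \in in_H1.
Proof.
elim: s => [|k s IH]; rewrite /zword ?big_nil ?H1_1 //.
by rewrite big_cons H1_Ml ?H1_z.
Qed.

Definition zH1 (s : seq nat) : H1 := MkH1 (H1_zword s).

Lemma zword0 : zword [::] = 1. Proof. exact: big_nil. Qed.
Lemma zword_cons k s : zword (k :: s) = z k * zword s.
Proof. exact: big_cons. Qed.
Lemma zword_cat s t : zword (s ++ t) = zword s * zword t.
Proof. exact: big_cat. Qed.

Definition zletters (s : seq nat) : seq bool :=
  flatten [seq rcons (nseq (k - 1) false) true | k <- s].

Lemma zE k : z k = word (rcons (nseq (k - 1) false) true).
Proof.
rewrite /z /Y /letter -cats1 -wordM; congr (_ * _).
elim: (k - 1)%N => [|n IH]; first by rewrite expr0 word0.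
by rewrite exprS IH wordM.
Qed.

Lemma zwordE s : zword s = word (zletters s).
Proof.
rewrite /zletters; elim: s => [|k s IH]; first by rewrite zword0 word0.
by rewrite zword_cons IH zE wordM.
Qed.

Lemma blocksK s : is_index s -> blocks 0 (zletters s) = s.
Proof.
rewrite /zletters; elim: s => //= -[|k] s IH //= /IH {}IH; rewrite subn1 /=.
suff H n u : blocks n (rcons (nseq k false) true ++ u) = (n + k).+1 :: blocks 0 u.
  by rewrite H IH.
by elim: k n => [|k IHk] n /=; rewrite ?addn0 // IHk addnS addSn.
Qed.

Lemma word_rcons_zword n u :
  exists2 s, is_index s & word (nseq n false ++ rcons u true) = zword s.
Proof.
elim: u n => [|[] u IH] n /=.
- exists [:: n.+1] => //.
  by rewrite zword_cons zword0 mulr1 zE subn1 /= -cats1.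
- have [s sI Es] := IH 0%N; exists (n.+1 :: s) => //.
  by rewrite zword_cons -Es zE wordM subn1 cat_rcons.
- have [s sI Es] := IH n.+1; exists s => //.
  rewrite -Es /=; congr word.
  by elim: n {IH Es} => //= n ->.
Qed.

Lemma H1_ind (P : QXY -> Prop) :
    (forall c f g, P f -> P g -> P (c *: f + g)) ->
    (forall s, is_index s -> P (zword s)) ->
  forall f, f \in in_H1 -> P f.
Proof.
move=> Plin Pw f /H1P[c [g ->]].
have P1 : P 1 by rewrite -zword0; apply: Pw.
have P0 : P 0 by have := Plin (-1) 1 1 P1 P1; rewrite scaleN1r addNr.
apply: (Plin); [exact: P1|rewrite (monalgE g) mulr_suml].
apply: (big_rec P); [exact: P0|move=> u h _ Ph].
have -> : << g@_u *g u >> = g@_u *: word u.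
  rewrite -mul_malgC malgM_def fgmulUU mulr1 mul1m.
  by congr (mkmalgU _ _); rewrite fmK.
rewrite -scalerAl; apply: Plin; last exact: Ph.
rewrite /Y /letter wordM cats1.
by have [s sI /= ->] := word_rcons_zword 0 u; apply: Pw.
Qed.

Lemma stuffle_zword s t : is_index s -> is_index t ->
  stuffle (zword s) (zword t) = stuffle_index s t.
Proof.
by move=> sI tI; rewrite (zwordE s) (zwordE t) /stuffle bilinext_word !blocksK.
Qed.

Lemma stuffle_indexs0 s : stuffle_index s [::] = zword s.
Proof. by case: s. Qed.

Lemma stuffle_index_cons a s b t : stuffle_index (a :: s) (b :: t) =
  z a * stuffle_index s (b :: t) + z b * stuffle_index (a :: s) t
  + z (a + b) * stuffle_index s t.
Proof. by []. Qed.

Lemma H1_stuffle_index s t : stuffle_index s t \in in_H1.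
Proof.
elim: s t => [|a s IHs] t; first exact: H1_zword.
elim: t => [|b t IHt]; first exact: H1_zword.
rewrite stuffle_index_cons.
by apply: rpredD; [apply: rpredD|]; apply: H1_Ml; rewrite ?H1_z.
Qed.

Lemma H1_stuffle f g : stuffle f g \in in_H1.
Proof.
by apply: rpred_sum => u _; apply: rpredZ; apply: rpred_sum => v _;
  apply: rpredZ; apply: H1_stuffle_index.
Qed.

Lemma stuffle_linl c f g h :
  stuffle (c *: f + g) h = c *: stuffle f h + stuffle g h.
Proof. exact: etrans (bilinextDl _ _ _ _) (congr1 (+%R^~ _) (bilinextZl _ _ _ _)). Qed.

Lemma stuffle_linr c f g h :
  stuffle h (c *: f + g) = c *: stuffle h f + stuffle h g.
Proof. exact: etrans (bilinextDr _ _ _ _) (congr1 (+%R^~ _) (bilinextZr _ _ _ _)). Qed.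

Lemma stuffle1l f : f \in in_H1 -> stuffle 1 f = f.
Proof.
exact: (@qsh_1l _ (fun f => f \in in_H1) zword stuffle_index stuffle zword0
  H1_ind (fun _ => erefl) stuffle_linr stuffle_zword).
Qed.

Lemma stuffleC f g : f \in in_H1 -> g \in in_H1 -> stuffle f g = stuffle g f.
Proof.
exact: (@qshC _ z (fun f => f \in in_H1) zword stuffle_index stuffle
  H1_ind (fun _ => erefl) stuffle_indexs0 stuffle_index_cons stuffle_linl
  stuffle_linr stuffle_zword).
Qed.

Lemma stuffle_z a b f g : (0 < a)%N -> (0 < b)%N ->
    f \in in_H1 -> g \in in_H1 ->
  stuffle (z a * f) (z b * g) =
    z a * stuffle f (z b * g) + z b * stuffle (z a * f) g
    + z (a + b) * stuffle f g.
Proof.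
exact: (@qsh_z _ z (fun f => f \in in_H1) zword stuffle_index stuffle
  mulQXY_scaler zword_cons H1_ind stuffle_index_cons stuffle_linl
  stuffle_linr stuffle_zword).
Qed.

Lemma stuffleA f g h : f \in in_H1 -> g \in in_H1 -> h \in in_H1 ->
  stuffle f (stuffle g h) = stuffle (stuffle f g) h.
Proof.
exact: (@qshA _ z (fun f => f \in in_H1) zword stuffle_index stuffle
  mulQXY_scaler zword0 zword_cons H1_ind H1_zword H1_stuffle (fun _ => erefl)
  stuffle_indexs0 stuffle_index_cons stuffle_linl stuffle_linr stuffle_zword).
Qed.

Lemma shuffle_cons a b u v : shuffle (word (a :: u)) (word (b :: v)) =
  letter a * shuffle (word u) (word (b :: v))
  + letter b * shuffle (word (a :: u)) (word v).
Proof. by rewrite /shuffle !bilinext_word. Qed.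

Lemma shuffle_word0l u : shuffle 1 (word u) = word u.
Proof. by rewrite -word0 /shuffle bilinext_word. Qed.

Lemma shuffle_word0r u : shuffle (word u) 1 = word u.
Proof. by rewrite -word0 /shuffle bilinext_word; case: u. Qed.

Definition stuffle_mul (f g : H1) : H1 := MkH1 (H1_stuffle f g).
Definition H1_one : H1 := MkH1 H1_1.

Lemma stuffle_mulA : associative stuffle_mul.
Proof. by move=> f g h; apply: val_inj; apply: stuffleA; apply: valP. Qed.
Lemma stuffle_mulC : commutative stuffle_mul.
Proof. by move=> f g; apply: val_inj; apply: stuffleC; apply: valP. Qed.
Lemma stuffle_mul1l : left_id H1_one stuffle_mul.
Proof. by move=> f; apply: val_inj; apply: stuffle1l; apply: valP. Qed.
Lemma stuffle_mulDl : left_distributive stuffle_mul +%R.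
Proof. by move=> f g h; apply: val_inj; exact: bilinextDl. Qed.
Lemma H1_one_neq0 : H1_one != 0.
Proof. by apply/eqP => /(congr1 val) /= /eqP; rewrite oner_eq0. Qed.

(* The ring H^1_*: multiplication on H1 is the stuffle product (concatenation
   is only available in QXY). *)
HB.instance Definition _ := GRing.Zmodule_isComNzRing.Build H1
  stuffle_mulA stuffle_mulC stuffle_mul1l stuffle_mulDl H1_one_neq0.

Lemma stuffle_mulZl (c : rat) (f g : H1) : c *: (f * g) = (c *: f) * g.
Proof. by apply: val_inj; apply: esym; exact: bilinextZl. Qed.

HB.instance Definition _ := GRing.Lmodule_isLalgebra.Build rat H1 stuffle_mulZl.
HB.instance Definition _ := GRing.Lalgebra_isComAlgebra.Build rat H1.

Lemma zH1_nil : zH1 [::] = 1.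
Proof. by apply: val_inj; exact: zword0. Qed.

Lemma last_word u : u != [::] -> last true u -> exists g, word u = g * Y.
Proof.
case/lastP: u => // u a _; rewrite last_rcons => ->.
by exists (word u); rewrite wordM cats1.
Qed.

Lemma factor_right (A : nzRingType) (a b g h y : A) :
  a * (g * y) + b * (h * y) = (a * g + b * h) * y.
Proof. by rewrite mulrDl !mulrA. Qed.

Lemma shuffle_word_Y u v : last true u -> last true v ->
  ~~ (nilp u && nilp v) -> exists g, shuffle_word u v = g * Y.
Proof.
have lastW (a : bool) s : last a s -> last true s by case: s.
elim: u v => [|a u IHu] v; first by case: v => // b v _ lv _; apply: last_word.
elim: v => [|b v IHv] lu lv _; first exact: last_word.
have [g Eg] := IHu (b :: v) (lastW a u lu) lv (negbT (andbF _)).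
have [h Eh] := IHv lu (lastW b v lv) isT.
exists (letter a * g + letter b * h).
transitivity (letter a * shuffle_word u (b :: v)
            + letter b * shuffle_word (a :: u) v); first by [].
by rewrite Eg Eh; apply: factor_right.
Qed.

Lemma last_zletters s : last true (zletters s).
Proof.
rewrite /zletters; elim/last_ind: s => //= s k _.
by rewrite map_rcons flatten_rcons last_cat last_rcons.
Qed.

Lemma shuffle_zword s t :
  shuffle (zword s) (zword t) = shuffle_word (zletters s) (zletters t).
Proof. by rewrite (zwordE s) (zwordE t) /shuffle bilinext_word. Qed.

Lemma H1_shuffle s t : shuffle (zword s) (zword t) \in in_H1.
Proof.
rewrite shuffle_zword.
have := @shuffle_word_Y _ _ (last_zletters s) (last_zletters t).
case: (zletters s) (zletters t) => [|a u] [|b v] H.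
- by rewrite /= word0 H1_1.
- by have [g ->] := H isT; apply: H1_Y.
- by have [g ->] := H isT; apply: H1_Y.
- by have [g ->] := H isT; apply: H1_Y.
Qed.

Definition wt (s : seq nat) : nat := sumn s.

(* w sh v - (-1)^wt(w) R(w) v for the words w = zword s and v = zword t, so
   that R(w) = zword (rev s); R(w) v is a concatenation, taken in QXY. *)
Definition frakL_gen_def (s t : seq nat) : QXY :=
  shuffle (zword s) (zword t) - (-1) ^+ wt s *: (zword (rev s) * zword t).

Lemma H1_frakL_gen s t : frakL_gen_def s t \in in_H1.
Proof.
by apply: rpredB; [exact: H1_shuffle|apply: rpredZ; apply: H1_Ml; exact: H1_zword].
Qed.

Definition frakL_gen (s t : seq nat) : H1 := MkH1 (H1_frakL_gen s t).

Local Open Scope classical_set_scope.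

Definition gen_ideal (A : comNzRingType) (G : set A) : set A :=
  [set f | exists (n : nat) (a g : 'I_n -> A),
     (forall i, G (g i)) /\ f = \sum_(i < n) a i * g i].

Definition span (K : nzRingType) (V : lmodType K) (G : set V) : set V :=
  [set f | exists (n : nat) (c : 'I_n -> K) (g : 'I_n -> V),
     (forall i, G (g i)) /\ f = \sum_(i < n) c i *: g i].

Definition frakL_gens : set H1 :=
  [set f | exists s t, [/\ is_index s, is_index t & f = frakL_gen s t]].

Definition frakL : {pred H1} := fun f => `[< gen_ideal frakL_gens f >].

(* L is a proper ideal: all its elements have constant term 0. *)
Definition aug : QXY -> rat := mcoeff mone.

Lemma augD f g : aug (f + g) = aug f + aug g. Proof. exact: mcoeffD. Qed.
Lemma augZ c f : aug (c *: f) = c * aug f. Proof. exact: mcoeffZ. Qed.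
Lemma augM f g : aug (f * g) = aug f * aug g.
Proof. exact: (mcoeff1g_is_multiplicative _ _).1. Qed.
Lemma aug_letter b : aug (letter b) = 0.
Proof.
rewrite /aug /letter /word mcoeffU (_ : _ == _ = false) //.
by apply/negP => /eqP /(congr1 val) /=; rewrite fm1.
Qed.
Lemma aug_z k : aug (z k) = 0.
Proof. by rewrite /z augM [aug Y]aug_letter mulr0. Qed.
Lemma aug1 : aug 1 = 1. Proof. exact: (mcoeff1g_is_multiplicative _ _).2. Qed.
Lemma aug_zword s : aug (zword s) = (nilp s)%:R.
Proof.
case: s => [|k s]; first by rewrite zword0 aug1.
by rewrite zword_cons augM aug_z mul0r.
Qed.
Lemma aug_word u : aug (word u) = (nilp u)%:R.
Proof.
case: u => [|a u]; first by rewrite word0 aug1.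
by rewrite -cat1s -wordM augM [aug (word [:: a])]aug_letter mul0r.
Qed.

Lemma aug_zM a f : aug (z a * f) = 0.
Proof. by rewrite augM aug_z mul0r. Qed.

Lemma aug_stuffle f g : f \in in_H1 -> g \in in_H1 ->
  aug (stuffle f g) = aug f * aug g.
Proof.
move: f g.
exact: (@qsh_aug _ z (fun f => f \in in_H1) zword stuffle_index stuffle
  zword0 zword_cons H1_ind (fun _ => erefl) stuffle_indexs0 stuffle_index_cons
  stuffle_linl stuffle_linr stuffle_zword aug augD augZ aug_zM aug1).
Qed.

Lemma aug_shuffle_word u v :
  aug (shuffle_word u v) = (nilp u && nilp v)%:R.
Proof.
case: u => [|a u]; first by rewrite -(aug_word v).
case: v => [|b v]; first exact: (aug_word (a :: u)).
transitivity (aug (letter a * shuffle_word u (b :: v)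
            + letter b * shuffle_word (a :: u) v)); first by [].
have augL c f : aug (letter c * f) = 0 by rewrite augM aug_letter mul0r.
have add00 (p q : rat) : p = 0 -> q = 0 -> p + q = 0 by move=> -> ->.
by rewrite augD; apply: add00; apply: augL.
Qed.

Lemma aug_frakL_gen s t : is_index s -> is_index t -> aug (frakL_gen s t) = 0.
Proof.
move=> sI tI; rewrite /= /frakL_gen_def -scaleNr augD augZ augM !aug_zword.
rewrite shuffle_zword aug_shuffle_word.
have nilp_zl r : nilp (zletters r) = nilp r.
  by case: r => //= k r; rewrite /zletters /= -cats1 /nilp !size_cat addn1.
have -> : nilp (rev s) = nilp s by rewrite /nilp size_rev.
rewrite !nilp_zl -natrM mulnb; case: nilP => [->|_] /=; last by rewrite mulr0 addr0.
by rewrite expr0 mulN1r subrr.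
Qed.

Lemma frakL_idealr : idealr_closed frakL.
Proof.
split.
- apply/asboolP; exists 0, (fun _ => 0), (fun _ => 0).
  by split=> [[]|]; rewrite ?big_ord0.
- apply/asboolP => -[n [a [g [Gg /(congr1 (fun f : H1 => aug f))]]]].
  have aug_sum (F : 'I_n -> H1) : aug (\sum_(i < n) F i) = \sum_(i < n) aug (F i).
    by apply: (big_morph (fun f : H1 => aug f) (id1 := 0)) => [f h|];
      [exact: augD|exact: mcoeff0].
  rewrite aug_sum big1 => [|i _]; first by rewrite [aug _]aug1 => /eqP; rewrite oner_eq0.
  have [s [t [sI tI Egi]]] := Gg i.
  have -> : aug (a i * g i) = aug (a i) * aug (g i) by apply: aug_stuffle; apply: H1valP.
  by rewrite Egi aug_frakL_gen // mulr0.
- move=> a f g /asboolP[m [b [u [Gu ->]]]] /asboolP[n [c [v [Gv ->]]]].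
  apply/asboolP; exists (m + n)%N.
  exists (fun i => match split i with inl j => a * b j | inr j => c j end).
  exists (fun i => match split i with inl j => u j | inr j => v j end).
  split=> [i|]; first by case: (split i).
  rewrite big_split_ord mulr_sumr /=; congr (_ + _); apply: eq_bigr => i _.
    by rewrite (unsplitK (inl i)) mulrA.
  by rewrite (unsplitK (inr i)).
Qed.

HB.instance Definition _ := isIdealr.Build H1 frakL frakL_idealr.

Definition Zf : Type := {ideal_quot frakL}.
HB.instance Definition _ := GRing.ComNzRing.on Zf.
HB.instance Definition _ := Quotient.on Zf.

Lemma Zf_eqP (f g : H1) :
  (\pi_Zf f = \pi_Zf g) <-> gen_ideal frakL_gens (f - g).
Proof.
split=> [E|E]; first by apply/asboolP; rewrite -[asbool _]/((f - g) \in frakL) Quotient.idealrBE; apply/eqP.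
by apply/eqP; rewrite -Quotient.idealrBE; apply/asboolP.
Qed.

Definition Zf_scale (c : rat) (x : Zf) : Zf := \pi_Zf (c *: repr x).

Lemma Zf_scale_pi c f : Zf_scale c (\pi_Zf f) = \pi_Zf (c *: f).
Proof.
apply/eqP; rewrite -Quotient.idealrBE -scalerBr -mulr_algl; apply: idealMr.
by rewrite Quotient.idealrBE; apply/eqP; rewrite reprK.
Qed.

Lemma Zf_scaleA b c x : Zf_scale b (Zf_scale c x) = Zf_scale (b * c) x.
Proof.
by elim/quotW: x => f; rewrite (Zf_scale_pi c) (Zf_scale_pi b) scalerA Zf_scale_pi.
Qed.
Lemma Zf_scale1 : left_id 1 Zf_scale.
Proof. by move=> x; rewrite -[x]reprK Zf_scale_pi scale1r. Qed.
Lemma Zf_scaleDr : right_distributive Zf_scale +%R.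
Proof.
by move=> c x y; rewrite -[x]reprK -[y]reprK -rmorphD !Zf_scale_pi scalerDr rmorphD.
Qed.
Lemma Zf_scaleDl x : {morph Zf_scale^~ x : b c / b + c}.
Proof. by move=> b c; rewrite -[x]reprK !Zf_scale_pi scalerDl rmorphD. Qed.

HB.instance Definition _ := GRing.Zmodule_isLmodule.Build rat Zf
  Zf_scaleA Zf_scale1 Zf_scaleDr Zf_scaleDl.

Lemma Zf_pi_linear c (f g : H1) :
  \pi_Zf (c *: f + g) = c *: \pi_Zf f + \pi_Zf g.
Proof.
rewrite (rmorphD (\pi_Zf)); congr (_ + _); exact: esym (Zf_scale_pi c f).
Qed.

Lemma Zf_scaleAl c (x y : Zf) : c *: (x * y) = (c *: x) * y.
Proof.
elim/quotW: x => f; elim/quotW: y => g; rewrite -(rmorphM (\pi_Zf)).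
transitivity (\pi_Zf (c *: (f * g))); first exact: Zf_scale_pi.
rewrite scalerAl (rmorphM (\pi_Zf)); congr (_ * _); exact: esym (Zf_scale_pi c f).
Qed.

HB.instance Definition _ := GRing.Lmodule_isLalgebra.Build rat Zf Zf_scaleAl.
HB.instance Definition _ := GRing.Lalgebra_isComAlgebra.Build rat Zf.

Definition zetaf (s : seq nat) : Zf := \pi_Zf (zH1 s).

Definition Fil (d k : nat) : set Zf :=
  span [set x | exists s, [/\ is_index s, (size s <= d)%N, wt s = k
                            & x = zetaf s]].

(* Main.v *)
From HB Require Import structures.
Require Import Defs.
From mathcomp Require Import all_boot all_algebra.
From mathcomp Require Import generic_quotient ring_quotient.
From mathcomp Require Import boolp classical_sets.
From mathcomp.multinomials Require Import monalg.
From mathcomp Require Import ring zify.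

Set Implicit Arguments.
Unset Strict Implicit.
Unset Printing Implicit Defensive.

Import GRing.Theory Num.Theory.
Local Open Scope ring_scope.

(** Write Z(k_1,...,k_r) for the class of z_{k_1}...z_{k_r}. The proof uses
    three families of relations: the stuffle product, the reversal
    Z(rev s) = (-1)^wt Z(s) (the shuffle relation with v = 1), and the expansion
    of z_1 sh s, whose value is -Z(1,s) (the shuffle relation with w = z_1).

    Depth 1: Z(k) = 0 ([ds_depth1]). Reversal gives this for odd k. For even k,
    once the smaller single zetas vanish, stuffle and reversal give
    Z(a,b) = -Z(k)/2 for all a + b = k, and z_1 sh z_{k-1} becomes
    (k+1) Z(k) = 0. Single zetas being zero, the stuffle product of a letter
    with any word vanishes, so Z(b,a) = -Z(a,b), and reversal kills Z(a,b) in
    even weight: this is depth 2.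

    Depth 3 and 4 rest on the antipode of the quasi-shuffle algebra, which
    compares a word with its reversal modulo products and lower depth. In
    depth 3 every product has a factor Z(k) and vanishes; in odd weight the antipode and
    the reversal have opposite signs, and adding up the terms of lower depth
    gives 2 Z(a,b,c) = -(Z(a,b+c) + Z(a+b,c)) ([ds_depth3]). In depth 4 and
    even weight they identify a word with its reversal up to the products of
    two double zetas, and 2 Z(a,b,c,d) = Z(a,b) Z(c,d) modulo depth 3
    ([ds_depth4]).

    It remains to see that such products have depth 3. Only double zetas of odd
    weight matter, and these span at most a line in each weight: inserting [ds_depth3]
    into z_1 sh z_a z_b leaves (a+1) Z(a+1,b) = -(b+1) Z(a,b+1), so
    Z(a,b) is a multiple of Z(1,a+b-1) ([ds_depth2_line]). It is enough then to
    treat Z(a,1) Z(1,c) with a and c even, and this is what z_1 sh z_a z_1 z_c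
    gives modulo depth 3: in each block that is split the sum over i of
    Z(i,a+1-i) is zero by antisymmetry, and the three words left over
    contribute a nonzero multiple of Z(a,1) Z(1,c) ([ds_depth2_prod]). *)

(** * Linear spans *)

Section Span.
Variables (K : nzRingType) (V : lmodType K) (G : set V).

Definition in_span : {pred V} := fun x => `[< Defs.span G x >].

Lemma in_spanP x : reflect (Defs.span G x) (x \in in_span).
Proof. exact: asboolP. Qed.

Lemma in_span_gen x : G x -> x \in in_span.
Proof.
move=> Gx; apply/in_spanP; exists 1%N, (fun=> 1), (fun=> x).
by split=> //; rewrite big_ord1 scale1r.
Qed.

Lemma in_span_submod : submod_closed in_span.
Proof.
split=> [|c x y /in_spanP[m [a [g [Gg ->]]]] /in_spanP[n [b [h [Gh ->]]]]].
  by apply/in_spanP; exists 0%N, (fun=> 0), (fun=> 0); split=> [[]|] //; rewrite big_ord0.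
apply/in_spanP; exists (m + n)%N.
exists (fun i => match split i with inl j => c * a j | inr j => b j end).
exists (fun i => match split i with inl j => g j | inr j => h j end).
split=> [i|]; first by case: (split i).
rewrite big_split_ord scaler_sumr; congr (_ + _); apply: eq_bigr => i _.
  by rewrite (unsplitK (inl i)) scalerA.
by rewrite (unsplitK (inr i)).
Qed.

HB.instance Definition _ :=
  GRing.isSubmodClosed.Build K V in_span in_span_submod.

Lemma in_span_sub (H : set V) x : (forall g, H g -> g \in in_span) ->
  Defs.span H x -> x \in in_span.
Proof.
move=> HG [n [c [g [Hg ->]]]]; apply: rpred_sum => i _.
by apply: rpredZ; apply: HG.
Qed.

End Span.

(** * Consequences of the double shuffle relations *)

(** The words of the stuffle product of two indices, with multiplicity. *)
Fixpoint stuffles (s t : seq nat) : seq (seq nat) :=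
  if s is a :: s' then
    (fix aux t := if t is b :: t'
       then map (cons a) (stuffles s' t) ++ map (cons b) (aux t')
            ++ map (cons (a + b)%N) (stuffles s' t')
       else [:: s]) t
  else [:: t].

(** The words of z_1 sh s, with multiplicity: a letter y inserted into the block
    x^(a-1) y of z_a cuts it into z_i z_(a+1-i). *)
Fixpoint insertions (s : seq nat) : seq (seq nat) :=
  if s is a :: s' then
    [seq [:: i, (a.+1 - i)%N & s'] | i <- index_iota 1 a.+1]
    ++ map (cons a) (insertions s')
  else [:: [:: 1%N]].

Lemma stuffles_cons a s b t : stuffles (a :: s) (b :: t) =
  map (cons a) (stuffles s (b :: t)) ++ map (cons b) (stuffles (a :: s) t)
  ++ map (cons (a + b)%N) (stuffles s t).
Proof. by []. Qed.

Lemma sum_insertions_nil (V : nmodType) (F : seq nat -> V) :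
  \sum_(r <- insertions [::]) F r = F [:: 1%N].
Proof. by rewrite big_seq1. Qed.

Lemma sum_insertions_cons (V : nmodType) (F : seq nat -> V) a s :
  \sum_(r <- insertions (a :: s)) F r =
  \sum_(1 <= i < a.+1) F [:: i, (a.+1 - i)%N & s]
  + \sum_(r <- insertions s) F (a :: r).
Proof. by rewrite big_cat !big_map. Qed.

Lemma stuffles_index s t r : is_index s -> is_index t -> r \in stuffles s t ->
  is_index r && (wt r == wt s + wt t)%N.
Proof.
rewrite /wt; elim: s t r => [|a s IHs] t r sI tI.
  by rewrite inE => /eqP->; rewrite tI /=.
elim: t tI r => [|b t IHt] tI r; first by rewrite inE => /eqP->; rewrite sI addn0 /=.
have [/andP[a0 s'I] /andP[b0 t'I]] := (sI, tI).
rewrite stuffles_cons !mem_cat => /or3P[] /mapP[q + ->].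
- by move=> /(IHs _ _ s'I tI)/andP[/= -> /eqP->]; rewrite a0 /= addnA.
- by move=> /(IHt t'I)/andP[/= -> /eqP->]; rewrite b0 /=; apply/eqP; lia.
- by move=> /(IHs _ _ s'I t'I)/andP[/= -> /eqP->]; rewrite addn_gt0 a0 /=; apply/eqP; lia.
Qed.

(** Parity is deduced from these relations in an arbitrary commutative algebra,
    which keeps terms of the quotient of Q<x,y> out of the computations. Both
    [ds_rev] and [ds_shuffle1] come from shuffle relations, with v = 1 and with
    w = z_1. *)
Record double_shuffle (A : comAlgType rat) (Z : seq nat -> A) : Prop := {
  ds_stuffle : forall s t, is_index s -> is_index t ->
    Z s * Z t = \sum_(r <- stuffles s t) Z r;
  ds_rev : forall s, is_index s -> Z (rev s) = (-1) ^+ wt s *: Z s;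
  ds_shuffle1 : forall s, is_index s ->
    \sum_(r <- insertions s) Z r = - Z (1%N :: s) }.

(** * Parity in depth at most four *)

Section Parity.
Variables (A : comAlgType rat) (Z : seq nat -> A).
Hypothesis dsZ : double_shuffle Z.

Definition filtration (d k : nat) : set A :=
  [set x | exists s, [/\ is_index s, (size s <= d)%N, wt s = k & x = Z s]].

Lemma mem_filtration d k s : is_index s -> (size s <= d)%N -> wt s = k ->
  Z s \in in_span (filtration d k).
Proof. by move=> sI sd sk; apply: in_span_gen; exists s. Qed.

Lemma eq_mem_trans (S : {pred A}) x y : x \in S -> y = x -> y \in S.
Proof. by move=> Sx ->. Qed.

Lemma halfE (x : A) : x = 2^-1 *: (x + x).
Proof. by rewrite -mulr2n -scaler_nat scalerA mulVf ?scale1r. Qed.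

Lemma mulrSn_eq0 (x : A) n : x *+ n.+1 = 0 -> x = 0.
Proof.
rewrite -scaler_nat => /eqP; rewrite scaler_eq0 pnatr_eq0 /=; exact: eqP.
Qed.

(** In even weight k, strong induction makes every Z(a,k-a) equal to -Z(k)/2,
    and the shuffle of z_1 with z_{k-1} is a sum of k such terms equated to the
    opposite of another one. *)
Lemma ds_depth1 k : (0 < k)%N -> Z [:: k] = 0.
Proof.
have [n] := ubnP k; elim: n k => // n IH k lt_kn k0.
have := ds_rev dsZ (s := [:: k]).
rewrite /= k0 /wt /= addn0 -signr_odd => /(_ isT).
case: (boolP (odd k)) => [_ | k_even _].
  by rewrite expr1 scaleN1r => E; rewrite (halfE (Z _)) {2}E subrr scaler0.
have ab a : (0 < a < k)%N -> Z [:: a; k - a]%N + Z [:: a; k - a]%N = - Z [:: k].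
  move=> ak.
  have aI : is_index [:: a; k - a]%N by rewrite /=; lia.
  have := ds_rev dsZ aI; rewrite /rev /wt /= addn0 subnKC; last lia.
  rewrite -signr_odd (negbTE k_even) scale1r => Er.
  have := @ds_stuffle _ _ dsZ [:: a] [:: (k - a)%N].
  rewrite IH; try lia.
  rewrite mul0r !big_cons big_nil /= Er subnKC; last lia.
  move=> /(_ _ _)/esym H; apply/eqP; rewrite -addr_eq0 -addrA; apply/eqP.
  by rewrite -[RHS]H ?addr0 //; rewrite /=; lia.
have := ds_shuffle1 dsZ (s := [:: k.-1]).
rewrite sum_insertions_cons sum_insertions_nil prednK //.
have -> : (k.-1 = k - 1)%N by lia.
have k1 : (1 < k)%N by case: k k0 k_even {lt_kn ab} => [|[|k]].
move=> /(_ _)E.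
have {}E : \sum_(1 <= i < k) Z [:: i; k - i]%N + Z [:: k - 1; 1]%N = - Z [:: 1; k - 1]%N.
  by apply: E; rewrite /=; lia.
have F : \sum_(1 <= i < k) (Z [:: i; k - i]%N + Z [:: i; k - i]%N) = - Z [:: k] *+ (k - 1).
  by rewrite -sumr_const_nat; apply: eq_big_nat => i ik; rewrite ab.
have E1 := ab 1%N k1.
have {ab}E2 : Z [:: k - 1; 1]%N + Z [:: k - 1; 1]%N = - Z [:: k].
  by have := ab (k - 1)%N; rewrite subKn //; apply; lia.
move: E F E1 E2; rewrite big_split /=.
move: (\sum_(_ <= _ < _) _) (Z [:: 1%N; _]) (Z [:: _; 1%N]) (Z [:: k]) => S x y w.
move=> E F E1 E2.
apply: (@mulrSn_eq0 w k); rewrite mulrS.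
have -> : w *+ k = w + w *+ (k - 1) by rewrite -mulrS; congr (_ *+ _); lia.
have -> : w *+ (k - 1) = - (S + S) by rewrite F mulNrn opprK.
have ES : S = - x - y by rewrite -E addrK.
rewrite ES; transitivity (w + w + (x + x) + (y + y)); first ring.
by rewrite E1 E2 addrK addrN.
Qed.

Lemma ds_stuffle1 a s : (0 < a)%N -> is_index s ->
  \sum_(r <- stuffles [:: a] s) Z r = 0.
Proof.
by move=> a0 sI; rewrite -ds_stuffle //= ?ds_depth1 ?mul0r ?a0.
Qed.

Lemma ds_depth2_anti a b : (0 < a)%N -> (0 < b)%N -> Z [:: b; a] = - Z [:: a; b].
Proof.
move=> a0 b0; have bI : is_index [:: b] by rewrite /= b0.
have := ds_stuffle1 a0 bI; rewrite /= !big_cons big_nil ds_depth1 ?addn_gt0 ?a0 //.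
by rewrite !addr0 addrC => /eqP; rewrite addr_eq0 => /eqP.
Qed.

(** Stuffle makes the double zetas antisymmetric, while in even weight reversal
    makes them symmetric. *)
Lemma ds_depth2_even a b : (0 < a)%N -> (0 < b)%N -> ~~ odd (a + b) ->
  Z [:: a; b] = 0.
Proof.
move=> a0 b0 ab_even; have abI : is_index [:: a; b] by rewrite /= a0 b0.
have := ds_rev dsZ abI; rewrite /rev /wt /= addn0 -signr_odd (negbTE ab_even).
rewrite scale1r ds_depth2_anti // => E.
by apply: (@mulrSn_eq0 _ 1); rewrite mulr2n -{1}E addNr.
Qed.

Lemma ds_depth2_sum n : \sum_(1 <= i < n.+1) Z [:: i; n.+1 - i]%N = 0.
Proof.
apply: (@mulrSn_eq0 _ 1); rewrite mulr2n {2}big_nat_rev -big_split /=.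
rewrite big_nat big1 // => i /andP[i0 lt_in].
have -> : (1 + n.+1 - i.+1 = n.+1 - i)%N by lia.
rewrite subKn; last by lia.
by rewrite [Z [:: _ - i; i]%N]ds_depth2_anti ?subrr // subn_gt0.
Qed.

(** The difference of the two vanishing stuffle products z_a * z_b z_c and
    z_c * z_b z_a is Z(a,b,c) - Z(c,b,a) up to depth 2, and reversal
    turns this into 2 Z(a,b,c). *)
Lemma ds_depth3 a b c : (0 < a)%N -> (0 < b)%N -> (0 < c)%N -> odd (a + b + c) ->
  Z [:: a; b; c] *+ 2 = - (Z [:: a; b + c]%N + Z [:: a + b; c]%N).
Proof.
move=> a0 b0 c0 k_odd.
have bcI : is_index [:: b; c] by rewrite /= b0 c0.
have baI : is_index [:: b; a] by rewrite /= b0 a0.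
have abcI : is_index [:: a; b; c] by rewrite /= a0 b0 c0.
have := ds_stuffle1 a0 bcI; have := ds_stuffle1 c0 baI.
have := ds_rev dsZ abcI; rewrite /rev /wt /= addn0 addnA -signr_odd k_odd.
rewrite !big_cons !big_nil expr1 scaleN1r => ->.
rewrite (addnC c b) (addnC c a) (@ds_depth2_anti a (b + c)%N) //; last by lia.
move: (Z [:: a; _; _]) (Z [:: b; c; _]) (Z [:: b; a; _]) => x y t.
move: (Z [:: b; _]) (Z [:: _; c]) (Z [:: a; _]) => p q r E1 E2.
apply/eqP; rewrite -subr_eq0 opprK; apply/eqP.
by rewrite -[RHS](subrr 0) -[X in _ = X - _]E2 -[X in _ = _ - X]E1; ring.
Qed.

(** The formula of [ds_depth3] turns the triple zetas of z_1 sh z_a z_b into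
    double zetas. Those that move with the place of the cut add up to the sum of
    all double zetas of that weight, which is zero by antisymmetry. *)
Lemma ds_depth2_ratio a b : (0 < a)%N -> (0 < b)%N -> ~~ odd (a + b) ->
  Z [:: a.+1; b] *+ a.+1 = - Z [:: a; b.+1] *+ b.+1.
Proof.
move=> a0 b0 ab_even; have abI : is_index [:: a; b] by rewrite /= a0 b0.
have := ds_shuffle1 dsZ abI.
rewrite !sum_insertions_cons sum_insertions_nil.
move=> /(congr1 (fun x => x *+ 2)); rewrite !mulrnDl mulNrn -!sumrMnl.
rewrite !ds_depth3; try lia.
have const (x : A) n : \sum_(1 <= i < n.+1) x = x *+ n.
  by rewrite sumr_const_nat subn1.
have -> : \sum_(1 <= i < a.+1) Z [:: i; a.+1 - i; b]%N *+ 2 =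
   - (\sum_(1 <= i < a.+1) Z [:: i; (a + b).+1 - i]%N + Z [:: a.+1; b] *+ a).
  rewrite -const -big_split -sumrN.
  apply: eq_big_nat => i /andP[i0 lt_ia]; rewrite ds_depth3; try lia.
  by congr (- (Z _ + Z _)); congr [:: _; _]; lia.
(* The cuts of z_b continue the range of the cuts of z_a, shifted by a. *)
have -> : \sum_(1 <= i < b.+1) Z [:: a; i; b.+1 - i]%N *+ 2 =
   - (Z [:: a; b.+1] *+ b + \sum_(a.+1 <= i < (a + b).+1) Z [:: i; (a + b).+1 - i]%N).
  rewrite -{1}(add1n a) big_addn subSn ?leq_addr // addKn.
  rewrite -const -big_split -sumrN.
  apply: eq_big_nat => i /andP[i0 lt_ib]; rewrite ds_depth3; try lia.
  by congr (- (Z _ + Z _)); congr [:: _; _]; lia.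
have := ds_depth2_sum (a + b).
rewrite (@big_cat_nat _ _ _ a.+1) //=; last by rewrite ltnS leq_addr.
move=> /eqP; rewrite addr_eq0 => /eqP ->.
rewrite (@ds_depth2_anti 1 (a + b)%N) ?addn_gt0 ?a0 // addn1.
move: (\sum_(_ <= _ < _) _) (Z [:: a.+1; b]) (Z [:: a; _]) (Z [:: _; _]).
move=> S x y t; rewrite !mulrS mulNrn.
move: (x *+ a) (y *+ b) => xa yb /eqP; rewrite -subr_eq0 => /eqP E.
by apply/eqP; rewrite -subr_eq0 -oppr_eq0 -E; apply/eqP; ring.
Qed.

(** In odd weight [ds_depth2_ratio] expresses each double zeta through its
    neighbour, so that Z(a,b) is proportional to (-1)^a times the binomial
    coefficient of a+b over a. *)
Lemma ds_depth2_line a b : (0 < a)%N -> (0 < b)%N -> odd (a + b) ->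
  exists c : rat, Z [:: a; b] = c *: Z [:: 1%N; (a + b).-1].
Proof.
elim: a b => // -[|a] IH b _ b0 ab_odd; first by exists 1; rewrite scale1r.
have [|c Ec] := IH b.+1 isT isT; first by rewrite addnS -addSn.
exists (- (a.+2%:R^-1 * (b.+1%:R * c))).
have ab_even : ~~ odd (a.+1 + b) by rewrite !addSn /= in ab_odd *.
have := ds_depth2_ratio (ltn0Sn a) b0 ab_even.
move=> /(congr1 (fun x => a.+2%:R^-1 *: x)).
rewrite -scaler_nat scalerA mulVf ?pnatr_eq0 // scale1r => ->.
by rewrite Ec mulNrn -scaler_nat scalerN !scalerA -scaleNr mulrA !addnS !addSn.
Qed.

Lemma ds_stuffle_top s t d k : is_index s -> is_index t ->
    (size s + size t <= d.+1)%N -> (wt s + wt t)%N = k ->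
  Z s * Z t - \sum_(r <- [seq r <- stuffles s t | (d < size r)%N]) Z r
    \in in_span (filtration d k).
Proof.
move=> sI tI le_d <-; rewrite ds_stuffle // big_filter (bigID (fun r => d < size r)%N) /=.
rewrite addrAC addrN add0r big_seq_cond; apply: rpred_sum => r.
rewrite -leqNgt => /andP[/(stuffles_index sI tI)/andP[rI /eqP r_wt] r_le].
exact: mem_filtration.
Qed.

(** The antipode identity for the shuffles of four letters reads
    dcba - (a sh dcb) + (ab sh dc) - (abc sh d) + abcd = 0. Products with a
    single zeta vanish, reversal identifies dcba with abcd, and Z(d,c) = -Z(c,d). *)
Lemma ds_depth4 a b c d k :
    is_index [:: a; b; c; d] -> (a + b + c + d)%N = k -> ~~ odd k ->
  Z [:: a; b; c; d] *+ 2 - Z [:: a; b] * Z [:: c; d]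
    \in in_span (filtration 3 k).
Proof.
move=> abcdI k_sum k_even; have /and5P[a0 b0 c0 d0 _] := abcdI.
have := ds_rev dsZ abcdI; rewrite /rev /wt /= addn0 !addnA k_sum -signr_odd.
rewrite (negbTE k_even) scale1r => Er.
have aI : is_index [:: a] by rewrite /= a0.
have dI : is_index [:: d] by rewrite /= d0.
have abI : is_index [:: a; b] by rewrite /= a0 b0.
have dcI : is_index [:: d; c] by rewrite /= d0 c0.
have dcbI : is_index [:: d; c; b] by rewrite /= d0 c0 b0.
have abcI : is_index [:: a; b; c] by rewrite /= a0 b0 c0.
have k13 : (wt [:: a] + wt [:: d; c; b])%N = k by rewrite /wt /=; lia.
have k22 : (wt [:: a; b] + wt [:: d; c])%N = k by rewrite /wt /=; lia.
have k31 : (wt [:: a; b; c] + wt [:: d])%N = k by rewrite /wt /=; lia.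
have := ds_stuffle_top aI dcbI (leqnn 4) k13.
have := ds_stuffle_top abI dcI (leqnn 4) k22.
have := ds_stuffle_top abcI dI (leqnn 4) k31.
have -> : [seq r <- stuffles [:: a] [:: d; c; b] | (3 < size r)%N] =
  [:: [:: a; d; c; b]; [:: d; a; c; b]; [:: d; c; a; b]; [:: d; c; b; a]] by [].
have -> : [seq r <- stuffles [:: a; b] [:: d; c] | (3 < size r)%N] =
  [:: [:: a; b; d; c]; [:: a; d; b; c]; [:: a; d; c; b];
      [:: d; a; b; c]; [:: d; a; c; b]; [:: d; c; a; b]] by [].
have -> : [seq r <- stuffles [:: a; b; c] [:: d] | (3 < size r)%N] =
  [:: [:: a; b; c; d]; [:: a; b; d; c]; [:: a; d; b; c]; [:: d; a; b; c]] by [].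
rewrite !ds_depth1 // mul0r mulr0 (@ds_depth2_anti c d) // mulrN.
rewrite !big_cons !big_nil Er.
move: (Z [:: a; b] * _) => p F31 F22 F13.
have F := rpredB (rpredB F22 F13) F31.
by apply: (eq_mem_trans F); ring.
Qed.

(** Modulo depth 3, [ds_depth4] turns the five groups of terms of the relation
    for z_1 sh z_a z_1 z_c into products of double zetas. The two groups where
    z_a or z_c is cut give zero by [ds_depth2_sum]; with P = Z(a,1) Z(1,c) the
    others give P, -P and -P. *)
Lemma ds_depth2_prod a c : (0 < a)%N -> (0 < c)%N -> ~~ odd a -> ~~ odd c ->
  Z [:: a; 1%N] * Z [:: 1%N; c] \in in_span (filtration 3 (a + 1 + 1 + c)).
Proof.
move=> a0 c0 a_even c_even; set F := in_span _.
have a1cI : is_index [:: a; 1%N; c] by rewrite /= a0 c0.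
have := ds_shuffle1 dsZ a1cI.
rewrite !sum_insertions_cons sum_insertions_nil big_nat1.
have F1 : (\sum_(1 <= i < a.+1) Z [:: i; a.+1 - i; 1; c]%N) *+ 2 \in F.
  (* Subtracting a vanishing sum of products makes each summand an instance of
     ds_depth4. *)
  have E0 : \sum_(1 <= i < a.+1) Z [:: i; a.+1 - i]%N * Z [:: 1%N; c] = 0.
    by rewrite -mulr_suml ds_depth2_sum mul0r.
  rewrite -sumrMnl -[X in X \in F]subr0 -[X in _ - X]E0 -sumrB big_seq.
  apply: rpred_sum => i.
  rewrite mem_index_iota => ia.
  by apply: ds_depth4; rewrite /=; lia.
have F3 : (\sum_(1 <= i < c.+1) Z [:: a; 1; i; c.+1 - i]%N) *+ 2 \in F.
  have E0 : \sum_(1 <= i < c.+1) Z [:: a; 1%N] * Z [:: i; c.+1 - i]%N = 0.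
    by rewrite -mulr_sumr ds_depth2_sum mulr0.
  rewrite -sumrMnl -[X in X \in F]subr0 -[X in _ - X]E0 -sumrB big_seq.
  apply: rpred_sum => i.
  rewrite mem_index_iota => ic.
  by apply: ds_depth4; rewrite /=; lia.
have F2 : Z [:: a; 1; 1; c]%N *+ 2 - Z [:: a; 1%N] * Z [:: 1%N; c] \in F.
  by apply: ds_depth4; rewrite /=; lia.
have F4 : Z [:: a; 1; c; 1]%N *+ 2 - Z [:: a; 1%N] * Z [:: c; 1%N] \in F.
  by apply: ds_depth4; rewrite /=; lia.
have F5 : Z [:: 1; a; 1; c]%N *+ 2 - Z [:: 1%N; a] * Z [:: 1%N; c] \in F.
  by apply: ds_depth4; rewrite /=; lia.
move: F1 F2 F3 F4 F5; rewrite (@ds_depth2_anti 1 c) // (@ds_depth2_anti a 1) //.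
rewrite mulrN mulNr subn1 /=.
move: (\sum_(1 <= _ < a.+1) _) (\sum_(1 <= _ < c.+1) _) (Z [:: a; _; _; c]).
move: (Z [:: a; _; c; _]) (Z [:: _; a; _; c]) (Z [:: a; _] * _).
move=> x y p S T w F1 F2 F3 F4 F5 E.
have := rpredD (rpredD (rpredD F1 F2) F3) (rpredD F4 F5).
move=> FS; apply: (eq_mem_trans FS).
have -> : y = - (S + (w + (T + x))) by rewrite E opprK.
by ring.
Qed.

Lemma ds_depth4_mem a b c d : is_index [:: a; b; c; d] -> ~~ odd (a + b + c + d) ->
  Z [:: a; b; c; d] \in in_span (filtration 3 (a + b + c + d)).
Proof.
move=> abcdI k_even; have /and5P[a0 b0 c0 d0 _] := abcdI.
rewrite (halfE (Z _)) -mulr2n; apply: rpredZ.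
have F := ds_depth4 abcdI erefl k_even; rewrite -(rpredBr _ F) opprB addrC subrK.
case: (boolP (odd (a + b))) => [ab_odd | ab_even].
  have cd_odd : odd (c + d) by lia.
  have [p ->] := ds_depth2_line a0 b0 ab_odd.
  have [q ->] := ds_depth2_line c0 d0 cd_odd.
  rewrite -scalerAl -scalerAr; apply: rpredZ; apply: rpredZ.
  rewrite (@ds_depth2_anti (a + b).-1 1) //; last by lia.
  rewrite mulNr rpredN.
  have -> : (a + b + c + d = (a + b).-1 + 1 + 1 + (c + d).-1)%N by lia.
  by apply: ds_depth2_prod; lia.
by rewrite ds_depth2_even ?mul0r ?rpred0.
Qed.

Lemma ds_parity d k s : (0 < d <= 4)%N -> k = d %[mod 2] ->
    is_index s -> size s = d -> wt s = k -> Z s \in in_span (filtration d.-1 k).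
Proof.
move=> d_bounds kd sI.
case: s sI => [|a [|b [|c [|e [|]]]]] //= sI sd; try lia; subst d.
- by rewrite ds_depth1 ?rpred0 //; lia.
- by move=> wt_s; rewrite ds_depth2_even ?rpred0; rewrite /wt /= in wt_s; lia.
- move=> wt_s; rewrite /wt /= addn0 addnA in wt_s.
  rewrite (halfE (Z _)) -mulr2n ds_depth3; try lia.
  by apply: rpredZ; rewrite rpredN; apply: rpredD; apply: mem_filtration;
    rewrite /wt //=; lia.
- move=> wt_s; rewrite /wt /= addn0 !addnA in wt_s; rewrite -wt_s.
  by apply: ds_depth4_mem => //; lia.
Qed.
End Parity.

(** * The double shuffle relations of the formal finite zeta values *)

Local Open Scope quotient_scope.

Lemma sum_zword_cons a l :
  \sum_(r <- map (cons a) l) zword r = z a * \sum_(r <- l) zword r.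
Proof.
rewrite big_map mulr_sumr; apply: eq_bigr => r _; exact: zword_cons.
Qed.

Lemma stuffle_index_sum s t : stuffle_index s t = \sum_(r <- stuffles s t) zword r.
Proof.
elim: s t => [|a s IHs] t; first by rewrite big_seq1.
elim: t => [|b t IHt]; first by rewrite big_seq1.
rewrite stuffle_index_cons (IHs (b :: t)) (IHs t) IHt stuffles_cons.
have E3 (l1 l2 l3 : seq (seq nat)) : \sum_(r <- l1 ++ l2 ++ l3) zword r =
    \sum_(r <- l1) zword r + \sum_(r <- l2) zword r + \sum_(r <- l3) zword r.
  by rewrite !big_cat /= addrA.
rewrite E3; symmetry; congr (_ + _ + _); exact: sum_zword_cons.
Qed.

Lemma shuffle_Y_cons b v : shuffle_word [:: true] (b :: v) =
  word [:: true, b & v] + letter b * shuffle_word [:: true] v.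
Proof.
transitivity (letter true * word (b :: v) + letter b * shuffle_word [:: true] v).
  by [].
by congr (_ + _); exact: wordM.
Qed.

(** The letter y lands at one of the n+1 places in front of the final letter of
    the block x^n y, or behind the whole block. *)
Lemma shuffle_Y_block n v :
  shuffle_word [:: true] (nseq n false ++ true :: v) =
  \sum_(0 <= i < n.+1) word (nseq i false ++ true :: nseq (n - i) false ++ true :: v)
  + word (rcons (nseq n false) true) * shuffle_word [:: true] v.
Proof.
elim: n => [|n IH]; first by rewrite big_nat1; exact: shuffle_Y_cons.
have -> : nseq n.+1 false ++ true :: v = false :: (nseq n false ++ true :: v) by [].
rewrite shuffle_Y_cons IH mulrDr addrA.
rewrite [X in _ = X + _]big_nat_recl; last exact: leq0n.
rewrite [letter false * (_ * _)]mulrA wordM mulr_sumr.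
congr (_ + _ * _); congr (_ + _).
by apply: eq_bigr => i _; exact: wordM.
Qed.

Lemma zletters_cons k s :
  zletters (k :: s) = nseq (k - 1) false ++ true :: zletters s.
Proof. by rewrite /zletters /= cat_rcons. Qed.

Lemma shuffle_Y_zword s : is_index s ->
  shuffle (zword [:: 1%N]) (zword s) = \sum_(r <- insertions s) zword r.
Proof.
rewrite shuffle_zword; elim: s => [|a s IH] sI.
  by rewrite sum_insertions_nil zwordE.
have /andP[a0 s'I] := sI.
rewrite (zletters_cons a s) -[zletters [:: 1%N]]/[:: true] shuffle_Y_block.
rewrite sum_insertions_cons -zE; congr (_ + _).
  rewrite subn1 prednK // [RHS]big_add1; apply: eq_big_nat => i ia.
  rewrite zwordE !zletters_cons subn1.
  by congr (word (_ ++ _ :: nseq _ _ ++ _)); lia.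
have {}IH : shuffle_word [:: true] (zletters s) = \sum_(r <- insertions s) zword r.
  exact: IH.
rewrite IH mulr_sumr; apply: eq_bigr => r _; exact: esym (zword_cons _ _).
Qed.

Lemma pi_sum (f : H1) (l : seq (seq nat)) :
  H1val f = \sum_(r <- l) zword r -> \pi_Zf f = \sum_(r <- l) zetaf r.
Proof.
move=> Ef; have -> : f = \sum_(r <- l) zH1 r.
  apply: val_inj; rewrite [LHS]Ef.
  by elim/big_rec2: _ => // r x y _ ->.
elim: l {Ef} => [|r l IH]; first by rewrite !big_nil rmorph0.
rewrite !big_cons -IH; exact: (rmorphD (\pi_Zf)).
Qed.

Lemma pi_shuffle s t : is_index s -> is_index t ->
  \pi_Zf (MkH1 (H1_shuffle s t)) = (-1) ^+ wt s *: zetaf (rev s ++ t).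
Proof.
move=> sI tI.
have -> : MkH1 (H1_shuffle s t) = (-1) ^+ wt s *: zH1 (rev s ++ t) + frakL_gen s t.
  apply: val_inj; rewrite /= /frakL_gen_def zword_cat addrC.
  by rewrite subrK.
rewrite Zf_pi_linear -[RHS]addr0; congr (_ + _).
have <- : \pi_Zf 0 = 0 :> Zf by exact: rmorph0.
apply/Zf_eqP; rewrite subr0.
exists 1%N, (fun=> 1), (fun=> frakL_gen s t); split=> [_|]; first by exists s, t.
by rewrite big_ord1 mul1r.
Qed.

Lemma zetaf_double_shuffle : double_shuffle zetaf.
Proof.
split=> [s t sI tI|s sI|s sI].
- rewrite /zetaf -rmorphM; apply: pi_sum.
  by rewrite -stuffle_index_sum; exact: stuffle_zword.
- have := @pi_shuffle s [::] sI isT; rewrite cats0.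
  have -> : MkH1 (H1_shuffle s [::]) = zH1 s.
    by apply: val_inj; rewrite /= zword0 zwordE; exact: shuffle_word0r.
  rewrite -/(zetaf s) => ->.
  by rewrite scalerA -exprD addnn -mul2n exprM sqrrN expr1n scale1r.
- have <- : \pi_Zf (MkH1 (H1_shuffle [:: 1%N] s)) = - zetaf (1%N :: s).
    by rewrite pi_shuffle // expr1 scaleN1r.
  by apply: esym; apply: pi_sum; exact: shuffle_Y_zword.
Qed.

Local Close Scope quotient_scope.
Local Open Scope classical_set_scope.

Theorem theorem2 (k d : nat) (hk : (1 <= k)%N) (hd : (1 <= d)%N)
  (hkd : k = d %[mod 2]) (hd4 : (d <= 4)%N) :
  Fil d k `<=` Fil (d - 1)%N k.
Proof.
(* Words of depth less than d already lie in the smaller step of the filtration;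
   only words of depth exactly d need the parity relations. *)
move=> x Fx; apply/in_spanP; apply: in_span_sub Fx => _ [s [sI sd sk ->]].
have [s_eq|s_lt] : size s = d \/ (size s <= d - 1)%N by lia.
  rewrite subn1; apply: ds_parity s_eq sk => //; [exact: zetaf_double_shuffle|by rewrite hd].
exact: mem_filtration.
Qed.
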